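(* Let $u=u(t,x)$ be a classical solution, for $t$ in an interval $I$ of existence and $x\in\mathbb{R}$, to the Degasperis-Procesi equation $$\partial_t u+u\,\partial_x u+\partial_x L\big(\tfrac32u^2\big)=0,$$ which has a priori spatial symmetry, i.e. there is a function $\lambda\in C^1(\mathbb{R})$ such that $$u(t,x)=u(t,2\lambda(t)-x)\qquad\text{for all } t\in I,\ x\in\mathbb{R}.$$ Then $u$ is a steady solution (traveling wave): there exist a constant $c\in\mathbb{R}$ and a function $\phi:\mathbb{R}\to\mathbb{R}$ such that $u(t,x)=\phi(x-ct)$ for all $t\in I$, $x\in\mathbb{R}$.
   Context: $L=(1-\partial_x^2)^{-1}$ acts in the $x$ variable by convolution with $K(x)=\frac12e^{-|x|}$: $(Lf)(x)=\int_{\mathbb{R}}K(x-y)f(y)\,\mathrm{d}y$. A classical solution means that $u$ is continuously differentiable in $(t,x)$, that $u(t,\cdot)$ and $u_x(t,\cdot)$ are bounded for each $t\in I$ (so that the nonlocal term is well defined), and that the equation holds pointwise. *)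

(* Defs.v *)
From HB Require Import structures.
From mathcomp Require Import all_boot all_order all_algebra.
From mathcomp Require Import all_classical all_reals all_analysis.
Import Order.TTheory GRing.Theory Num.Theory.
Import numFieldNormedType.Exports.

Set Implicit Arguments.
Unset Strict Implicit.
Unset Printing Implicit Defensive.

Local Open Scope classical_set_scope.
Local Open Scope ring_scope.

Section DegasperisProcesi.
Context {R : realType}.
Implicit Types (I : set R) (f lambda : R -> R) (u : R -> R -> R) (t x : R).

(* Derivatives relative to a set I: one-sided at an endpoint of the interval I
   that belongs to I, and the usual derivative in its interior. *)
Definition difference_quotient f t : R -> R := fun s => (f s - f t) / (s - t).

Definition derivable_in I f t : Prop :=
  cvg (difference_quotient f t @ within I t^').

Definition derive_in I f t : R :=
  lim (difference_quotient f t @ within I t^').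

(* A function of (t, x) is written u t x and is total; its values for t
   outside the time interval I are never used. *)
Definition dt I u t x : R := derive_in I (fun s => u s x) t.

Definition dx u t x : R := derive1 (u t) x.

(* Only x ranges over an open set, hence the two notions of derivability. *)
Definition C1_on I u : Prop :=
  [/\ forall t x, I t -> derivable_in I (fun s => u s x) t,
      forall t x, I t -> derivable (u t) x 1,
      {within I `*` [set: R], continuous (fun p : R * R => dt I u p.1 p.2)} &
      {within I `*` [set: R], continuous (fun p : R * R => dx u p.1 p.2)}].

Definition C1 lambda : Prop :=
  (forall t, derivable lambda t 1) /\ continuous (derive1 lambda).

Definition K x : R := 2^-1 * expR (- `|x|).

Definition L f x : R :=
  \int[lebesgue_measure]_(y in [set: R]) (K (x - y) * f y).

(* For bounded continuous u t, the function L (3/2 u^2) is continuously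
   differentiable, so its derivative below is a genuine one. *)
Definition DP_classical_solution I u : Prop :=
  [/\ C1_on I u,
      forall t, I t -> bounded_fun (u t),
      forall t, I t -> bounded_fun (dx u t) &
      forall t x, I t ->
        dt I u t x + u t x * dx u t x
          + derive1 (L (fun y => 3 / 2 * u t y ^+ 2)) x = 0].

Definition symmetric_about I u lambda : Prop :=
  forall t x, I t -> u t x = u t (2 * lambda t - x).

Definition traveling_wave I u : Prop :=
  exists (c : R) (phi : R -> R), forall t x, I t -> u t x = phi (x - c * t).

End DegasperisProcesi.

(* Main.v *)
(** Reflecting x about lambda(t) changes the sign of
    u u_x + (L(3/2 u^2))_x, hence of u_t; differentiating the symmetry
    u(t, x) = u(t, 2 lambda(t) - x) in t then gives the transport equation
    u_t = - lambda'(t) u_x, so u(t, x + lambda(t)) does not depend on t.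
    All the profiles u(t, .) being translates of one another, the equation forces
    lambda'(t) u_x(t1, x) = lambda'(t1) u_x(t1, x) for all x: either u is constant
    or lambda is affine on I. *)
Require Import Defs.
From HB Require Import structures.
From mathcomp Require Import all_boot all_order all_algebra.
From mathcomp Require Import all_classical all_reals all_analysis.
From mathcomp Require Import measurable_realfun ring lra.
Import Order.TTheory GRing.Theory Num.Theory.
Import numFieldNormedType.Exports.

Set Implicit Arguments.
Unset Strict Implicit.
Unset Printing Implicit Defensive.

Local Open Scope classical_set_scope.
Local Open Scope ring_scope.

(** * Punctured neighbourhoods and derivatives under reflection *)

Lemma dnbhs0_opp (R : realType) : -%R @ (0 : R)^' = (0 : R)^'.
Proof.
rewrite -{2}[0 : R]oppr0 dnbhsN; apply/seteqP; split=> A /=.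
  by move=> A0; exists (-%R @^-1` A) => //; apply/seteqP; split=> x /=;
    [case=> y Ay <-|move=> Ax; exists (- x); rewrite /= ?opprK].
case=> B B0 <-; apply: filterS B0 => x Bx /=.
by exists x.
Qed.

(* No derivability is required: where the limit does not exist, both sides are
   the junk value 0. *)
Lemma derive1_reflect (R : realType) (f g : R -> R) (a : R) :
  (forall x, g x = f (a - x)) -> forall x, derive1 g x = - derive1 f (a - x).
Proof.
move=> gf x.
pose F (h : R) : R := h^-1 *: (f (h + (a - x)) - f (a - x)).
rewrite /derive1 -/F.
have -> : (fun h : R => h^-1 *: (g (h + x) - g x)) = - (F \o -%R).
  apply/funext => h; rewrite /= !fctE /F /= !gf invrN scaleNr opprK.
  by congr (_ *: (f _ - _)); ring.
have [cF|ncF] := pselect (cvg (F @ 0^')).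
  have cF' : cvg ((F \o -%R) @ (0 : R)^').
    by rewrite -[X in cvg X]/(F @ (-%R @ (0 : R)^')) dnbhs0_opp.
  have -> := limN cF'.
  by rewrite -[X in _ = - lim (F @ X)](dnbhs0_opp R).
have ncF' : ~ cvg ((- (F \o -%R)) @ (0 : R)^').
  rewrite is_cvgNE => cF; apply: ncF.
  by rewrite -[X in cvg (F @ X)](dnbhs0_opp R).
by rewrite (dvgP ncF) (dvgP ncF') oppr0.
Qed.

(** Makes limits along [within I t^'] unique, so that [dt] can be computed. The segment from [t] to
    [s] lies in [I] and has points arbitrarily close to [t]. *)
Lemma dnbhs_within_proper (R : realType) (I : set R) (s t : R) :
  is_interval I -> I s -> I t -> s != t -> ProperFilter (within I t^').
Proof.
move=> hI Is It st; apply: Build_ProperFilter_ex.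
move=> A; rewrite /within /= => -[e /= e0 He].
(* The bound 1 keeps [t + d * (s - t)] on the segment; the other bound keeps it within [e / 2] of
   [t]. *)
pose d := Num.min 1 (e / 2 / `|s - t|).
have st0 : 0 < `|s - t| by rewrite normr_gt0 subr_eq0.
have d0 : 0 < d by rewrite lt_min ltr01 !divr_gt0.
have d1 : d <= 1 by rewrite ge_min lexx.
exists (t + d * (s - t)); apply: He => /=.
- rewrite opprD addNKr normrN normrM (gtr0_norm d0).
  apply: (@le_lt_trans _ _ (e / 2)).
    by rewrite -ler_pdivlMr// ge_min lexx orbT.
  by rewrite ltr_pdivrMr// ltr_pMr// ltr1n.
- by rewrite -subr_eq0 addrAC subrr add0r mulf_neq0 ?subr_eq0// gt_eqF.
- have [stl|tsl|/eqP] := ltgtP s t; last by rewrite (negbTE st).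
    by apply: (hI s t) => //; apply/andP; split; nra.
  by apply: (hI t s) => //; apply/andP; split; nra.
Qed.

(** * Reflection invariance of Lebesgue measure and of the operator [L] *)

Lemma lebesgue_measure_reflect (R : realType) (a : R) (A : set R) :
  measurable A ->
  pushforward lebesgue_measure ((fun y => a - y) : R -> measurableTypeR R) A =
  lebesgue_measure A.
Proof.
move=> mA.
have mr : measurable_fun [set: R] ((fun y => a - y) : R -> measurableTypeR R).
  apply: continuous_measurable_fun => y.
  by apply: cvgB; [exact: cvg_cst|exact: cvg_id].
(* It suffices to compare half-open intervals: reflection moves the open end to the other side,
   which leaves the length unchanged. *)
apply/esym/lebesgue_measure_unique => //= _ [[b c]] _ <-.
rewrite /pushforward.
have -> : (fun y : R => a - y) @^-1` `]b, c]%classic = `[a - c, a - b[%classic.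
  by apply/seteqP; split=> y /=; rewrite !in_itv/=; lra.
rewrite !lebesgue_measure_itv/= !lte_fin ltrD2l ltrN2.
by case: ifP => // _; rewrite -!EFinB; congr _%:E; ring.
Qed.

Lemma ge0_integral_reflect (R : realType) (a : R) (f : R -> \bar R) :
  measurable_fun [set: R] f -> (forall x, 0 <= f x)%E ->
  (\int[lebesgue_measure]_(y in [set: R]) f (a - y)%R =
   \int[lebesgue_measure]_(y in [set: R]) f y)%E.
Proof.
move=> mf f0.
have mr : measurable_fun [set: R] ((fun y => a - y) : R -> measurableTypeR R).
  apply: continuous_measurable_fun => y.
  by apply: cvgB; [exact: cvg_cst|exact: cvg_id].
rewrite -[RHS](@eq_measure_integral _ _ _ _ lebesgue_measure
  (pushforward lebesgue_measure ((fun y => a - y) : R -> measurableTypeR R))).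
  by rewrite ge0_integral_pushforward.
by move=> A mA _; exact: lebesgue_measure_reflect.
Qed.

Lemma continuous_K (R : realType) : continuous (@K R).
Proof.
move=> x; rewrite /K; apply: cvgM; first exact: cvg_cst.
apply: (@continuous_comp _ _ _ (fun x : R => - `|x|) expR).
  by apply: cvgN; exact: norm_continuous.
exact: continuous_expR.
Qed.

(** Substitute [a - y] for [y] and use that [K] is even. Since the integrand is nonnegative, the
    substitution is made in the extended reals, before [fine] is taken. *)
Lemma L_reflect (R : realType) (f g : R -> R) (a : R) :
  continuous f -> (forall y, 0 <= f y) -> (forall y, g y = f (a - y)) ->
  forall x, L g x = L f (a - x).
Proof.
move=> cf f0 gf x; rewrite /L /Rintegral; congr fine.
have mG : measurable_fun [set: R] (fun y => K (a - x - y) * f y).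
  apply: continuous_measurable_fun => y.
  apply: cvgM; last exact: cf.
  apply: (@continuous_comp _ _ _ (fun y => a - x - y) (@K R)).
    by apply: cvgB; [exact: cvg_cst|exact: cvg_id].
  exact: continuous_K.
rewrite -[RHS](@ge0_integral_reflect R a (fun y => (K (a - x - y) * f y)%:E)).
- apply: eq_integral => y _; rewrite gf /K; congr (_ * expR (- _) * _)%:E.
  by rewrite -normrN; congr `|_|; ring.
- by apply/measurable_EFinP; exact: mG.
- by move=> y; rewrite lee_fin mulr_ge0// /K mulr_ge0 ?invr_ge0// expR_ge0.
Qed.

(** * Differential calculus relative to an interval *)

Lemma derivable_in0_cst (R : realType) (I : set R) (f : R -> R) :
  is_interval I ->
  (forall t, I t -> difference_quotient f t @ within I t^' --> (0 : R)) ->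
  forall a b, I a -> I b -> f a = f b.
Proof.
move=> hI f'0.
(* Near [t] the difference quotient is below 1 in absolute value, so [f s] is closer to [f t] than
   [s] is to [t]. *)
have cf t : I t -> f @ within I (nbhs t) --> f t.
  move=> It; apply/cvgrPdist_lt => e e0.
  have := f'0 t It => /cvgr_dist_lt/(_ 1 ltr01).
  rewrite !near_withinE !near_nbhs => H.
  have He : \forall s \near t, `|t - s| < e.
    by apply: nbhsx_ballx.
  near=> s => Is.
  have [->|st] := eqVneq s t; first by rewrite subrr normr0.
  have : `|0 - difference_quotient f t s| < 1 by move: st Is; near: s; exact: H.
  rewrite sub0r normrN normrM normfV ltr_pdivrMr ?normr_gt0 ?subr_eq0// mul1r.
  rewrite distrC => /lt_trans; apply; rewrite distrC; by near: s.
suff lt_case a b : I a -> I b -> a < b -> f a = f b.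
  move=> a b Ia Ib; have [ab|ba|->//] := ltgtP a b; first exact: lt_case.
  exact/esym/lt_case.
move=> Ia Ib ab.
have sub : `[a, b]%classic `<=` I.
  by move=> t /=; rewrite in_itv/=; exact: hI.
have [||c _] := @MVT _ f (fun=> 0) a b ab.
- move=> t tab.
  (* At an interior point the relative derivative is the ordinary one; at the endpoints the mean
     value theorem asks only for continuity. *)
  have nI : nbhs t I.
    apply: (@filterS _ _ _ `]a, b[%classic); last exact: near_in_itvoo.
    by move=> s /= sab; apply: sub; exact: subset_itv_oo_cc sab.
  have dq : difference_quotient f t @ t^' --> (0 : R).
    have It : I t by exact: nbhs_singleton.
    suff <- : within I t^' = t^' by exact: f'0.
    apply/seteqP; split=> A; last exact: cvg_within.
    rewrite /within/= => HA.
    by apply: filterS2 HA (nbhs_dnbhs nI) => s HA Is; exact: HA.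
  pose q (h : R) := h^-1 *: ((f \o shift t) (h *: (1 : R)) - f t).
  have H : q @ 0^' --> (0 : R).
    have -> : q = difference_quotient f t \o shift t.
      apply/funext => h /=.
      by rewrite /q /difference_quotient /= addrK mulrC [_ *: 1]mulr1.
    apply: cvg_comp dq => A [e /= e0 He]; exists e => //= h he h0.
    apply: He => /=.
      by rewrite opprD addrCA subrr addr0 -sub0r.
    by rewrite -subr_eq0 addrK.
  split; first by apply/cvg_ex; exists 0.
  exact: cvg_lim H.
- apply/subspace_continuousP => t tab.
  apply: cvg_trans (cf t (sub _ tab)); apply: cvg_app.
  by apply: within_subset.
- by rewrite mul0r => /eqP; rewrite subr_eq0 => /eqP.
Unshelve. all: by end_near.
Qed.

(** The increment of [u s (y s)] splits into one in time at fixed [y t] and one in space at fixed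
    [s]. The mean value theorem turns the latter into [dx u s (xi s) * (y s - y t)], and joint
    continuity of [dx u] gives the limit. *)
Lemma chain_rule_in (R : realType) (I : set R) (u : R -> R -> R) (y : R -> R)
    (t dy : R) :
  C1_on I u -> I t -> difference_quotient y t @ t^' --> dy ->
  ProperFilter (within I t^') ->
  difference_quotient (fun s => u s (y s)) t @ within I t^' -->
    dt I u t (y t) + dx u t (y t) * dy.
Proof.
move=> [ut ux _ cux] It y' pI.
have cy : y @ t^' --> y t.
  have H : (fun s => y t + difference_quotient y t s * (s - t)) @ t^' --> y t.
    rewrite -[X in _ --> X]addr0 -[X in _ + X](mulr0 dy) -[X in _ * X](subrr t).
    apply: cvgD; first exact: cvg_cst.
    apply: cvgM => //; apply: cvgB; last exact: cvg_cst.
    by apply: cvg_within_filter; exact: cvg_id.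
  apply: cvg_trans H; apply: near_eq_cvg; near=> s.
  rewrite /difference_quotient divfK ?subrKC// subr_eq0.
  by near: s; exact: nbhs_dnbhs_neq.
(* The mean value point for [u s] between [y t] and [y s]; outside [I] an arbitrary value is
   chosen. *)
have /choice[xi xiP] : forall s, exists x, I s ->
    `|x - y t| <= `|y s - y t| /\ u s (y s) - u s (y t) = dx u s x * (y s - y t).
  move=> s; have [Is|nIs] := pselect (I s); last by exists 0.
  have hd (z : R) : is_derive z (1 : R) (u s) (dx u s z).
    by split; [exact: ux|rewrite /dx derive1E].
  have hc A : {within A, continuous (u s)}.
    apply: continuous_subspaceT => z; apply: differentiable_continuous.
    by apply/derivable1_diffP; exact: ux.
  have [h|h] := leP (y t) (y s).
    have [x xI H] := MVT_segment h (fun z _ => hd z) (hc _).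
    exists x => _; split=> //; move: xI; rewrite in_itv/= => /andP[h1 h2].
    by rewrite !ger0_norm ?subr_ge0// lerD2r.
  have [x xI H] := MVT_segment (ltW h) (fun z _ => hd z) (hc _).
  exists x => _; split; last by rewrite -opprB H -mulrN opprB.
  move: xI; rewrite in_itv/= => /andP[h1 h2].
  by rewrite !ler0_norm ?subr_le0 ?(ltW h)// lerN2 lerD2r.
have cxi : xi @ within I t^' --> y t.
  apply/cvgrPdist_lt => e e0; rewrite near_withinE.
  move/cvgrPdist_lt : cy => /(_ e e0); apply: filterS => s hs Is.
  by rewrite distrC (le_lt_trans (xiP s Is).1)// distrC.
have cdx : (fun s => dx u s (xi s)) @ within I t^' --> dx u t (y t).
  have /subspace_continuousP/(_ (t, y t))/= H := cux.
  apply: (@cvg_comp _ _ _ (fun s => (s, xi s)) (fun p => dx u p.1 p.2) _ _ _ _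
    (H (conj It Logic.I))).
  have cs : (fun s => (s, xi s)) @ within I t^' --> (t, y t).
    have c1 : id @ within I t^' --> t.
      apply: (@cvg_within_filter _ _ _ t^').
      apply: (@cvg_within_filter _ _ _ (nbhs t)).
      exact: cvg_id.
    exact: (cvg_pair c1 cxi).
  move=> A /cs; rewrite /= !nbhs_simpl /= /within /= => HA.
  by apply: filterS HA => s HA Is; exact: HA.
have H : (fun s => difference_quotient (u^~ (y t)) t s +
            dx u s (xi s) * difference_quotient y t s) @ within I t^' -->
         dt I u t (y t) + dx u t (y t) * dy.
  apply: cvgD; first exact: ut.
  by apply: cvgM => //; exact: cvg_within_filter.
apply: cvg_trans H; apply: near_eq_cvg; rewrite near_withinE; near=> s => Is.
rewrite /difference_quotient mulrA -(xiP s Is).2 -mulrDl; congr (_ / _).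
by ring.
Unshelve. all: by end_near.
Qed.

Lemma cvg_difference_quotient (R : realType) (f : R -> R) (t : R) :
  derivable f t 1 -> difference_quotient f t @ t^' --> derive1 f t.
Proof.
move=> df; rewrite derive1E.
have H : (difference_quotient f t \o shift t) @ 0^' --> 'D_1 f t.
  apply: cvg_trans df; apply: near_eq_cvg; near=> h.
  by rewrite /difference_quotient /= addrK mulrC [h *: 1]mulr1.
have -> : difference_quotient f t =
    (difference_quotient f t \o shift t) \o shift (- t).
  by apply/funext => s /=; rewrite subrK.
apply: cvg_comp H => A [e /= e0 He]; exists e => //= s se st; apply: He => /=.
  by rewrite sub0r opprB.
by rewrite subr_eq0.
Unshelve. all: by end_near.
Qed.

Lemma dt_eq (R : realType) (I : set R) (u : R -> R -> R) (t x l : R) :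
  ProperFilter (within I t^') ->
  difference_quotient (u^~ x) t @ within I t^' --> l -> dt I u t x = l.
Proof. by move=> pI; exact: cvg_lim. Qed.

Lemma eq_difference_quotient_in (R : realType) (I : set R) (f g : R -> R)
    (t l : R) :
  I t -> (forall s, I s -> f s = g s) ->
  difference_quotient f t @ within I t^' --> l ->
  difference_quotient g t @ within I t^' --> l.
Proof.
move=> It fg; apply: cvg_trans; apply: near_eq_cvg.
rewrite near_withinE; near=> s => Is.
by rewrite /difference_quotient !fg.
Unshelve. all: by end_near.
Qed.

Theorem theorem4p1 (R : realType) (I : set R) (u : R -> R -> R)
    (lambda : R -> R) (hI : is_interval I)
    (hu : DP_classical_solution I u)
    (hlambda : C1 lambda)
    (hsym : symmetric_about I u lambda) :
  traveling_wave I u.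
Proof.
case: hu => C1u _ _ eqn; case: hlambda => dlambda _.
(* If [I] has at most one point, no time derivative is meaningful, but any profile is trivially a
   wave of speed 0. *)
have [Isub|[t1 [t2 [It1 It2 t12]]]] :
    (forall s t, I s -> I t -> s = t) \/
    exists t1 t2, [/\ I t1, I t2 & t1 != t2].
  have [|H] := pselect (exists t1 t2, [/\ I t1, I t2 & t1 != t2]).
    by right.
  left=> s t Is It; apply/eqP/negP => /negP st; apply: H; by exists s, t.
  have [[t0 It0]|I0] := pselect (exists t, I t); last first.
    by exists 0, (fun=> 0) => t x It; case: I0; exists t.
  by exists 0, (u t0) => t x It; rewrite mul0r subr0 (Isub t t0).
have pI t : I t -> ProperFilter (within I t^').
  move=> It; have [tt1|tt1] := eqVneq t1 t.
    by apply: (@dnbhs_within_proper _ _ t2) => //; rewrite -tt1 eq_sym.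
  exact: (@dnbhs_within_proper _ _ t1).
pose v t : R := derive1 lambda t.
have v_lim t : difference_quotient lambda t @ t^' --> v t.
  exact: cvg_difference_quotient.
pose N t x : R := derive1 (L (fun y => 3 / 2 * u t y ^+ 2)) x.
pose Q t x := u t x * dx u t x + N t x.
have {}eqn t x : I t -> dt I u t x = - Q t x.
  by move=> It; apply/eqP; rewrite -addr_eq0 /Q addrA; apply/eqP; exact: eqn.
have dx_reflect s t a : (forall x, u t x = u s (a - x)) ->
    forall x, dx u t x = - dx u s (a - x).
  exact: derive1_reflect.
have ux t x : I t -> derivable (u t) x 1 by case: C1u => _ + _ _; exact.
have cu t : I t -> continuous (u t).
  by move=> It x; apply/differentiable_continuous/derivable1_diffP/ux.
(* Reflection preserves [u] and [L (3/2 u^2)] and flips the sign of their x-derivatives. Two times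
   are allowed: [s = t] serves [transport], distinct times serve [speed]. *)
have Q_reflect s t a : I s -> (forall x, u t x = u s (a - x)) ->
    forall x, Q t x = - Q s (a - x).
  move=> Is us x; rewrite /Q us (dx_reflect s t a us).
  suff -> : N t x = - N s (a - x) by rewrite mulrN -opprD.
  apply: derive1_reflect.
  apply: L_reflect => [y|y|y]; last by rewrite us.
  - by apply: cvgM; [exact: cvg_cst|apply: cvgM; exact: cu].
  - by rewrite mulr_ge0 ?sqr_ge0.
have transport t x : I t -> dt I u t x = - v t * dx u t x.
  move=> It.
  have dq2 :
      difference_quotient (fun s => 2 * lambda s - x) t @ t^' --> 2 * v t.
    have -> : difference_quotient (fun s => 2 * lambda s - x) t =
        (fun s => 2 * difference_quotient lambda t s).
      by apply/funext => s; rewrite /difference_quotient; ring.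
    by apply: cvgM; [exact: cvg_cst|exact: v_lim].
  have H := chain_rule_in C1u It dq2 (pI t It).
  (* The symmetry differentiated in time. As [dt] and [dx] are both odd under the reflection, it
     reads [2 u_t = - 2 v u_x]. *)
  have e : dt I u t x = dt I u t (2 * lambda t - x) +
                        dx u t (2 * lambda t - x) * (2 * v t).
    apply: (dt_eq (pI t It)); apply: eq_difference_quotient_in H => // s Is.
    by rewrite -hsym.
  have tsym y : u t y = u t (2 * lambda t - y) by exact: hsym.
  rewrite (dx_reflect _ _ _ tsym) mulrNN.
  move: e; rewrite !eqn// (Q_reflect _ _ _ It tsym x) opprK.
  by move: (Q t _) (dx u t _) (v t) => q d w e; clear -e; lra.
have frozen x s t : I s -> I t -> u s (x + lambda s) = u t (x + lambda t).
  apply: (derivable_in0_cst (f := fun s => u s (x + lambda s)) hI) => {}t It.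
  have dq1 : difference_quotient (fun s => x + lambda s) t @ t^' --> v t.
    have -> : difference_quotient (fun s => x + lambda s) t =
        difference_quotient lambda t.
      by apply/funext => r; rewrite /difference_quotient; congr (_ / _); ring.
    exact: v_lim.
  have := chain_rule_in C1u It dq1 (pI t It).
  by rewrite transport//; congr (_ --> _); ring.
(* The translation [frozen] composed with the symmetry at time [s]: a reflection, the form that
   [Q_reflect] and [dx_reflect] take. *)
have flip s t x : I s -> I t -> u t x = u s (lambda s + lambda t - x).
  move=> Is It; have := frozen (x - lambda t) t s It Is; rewrite subrK => ->.
  by rewrite hsym//; congr (u s _); ring.
(* The relation [Q s = v s * dx u s], carried to time [t] by [flip], where both sides change sign,
   is compared with the one holding at [t]. *)
have speed s t x : I s -> I t -> (v t - v s) * dx u t x = 0.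
  move=> Is It.
  have Qv r y : I r -> Q r y = v r * dx u r y.
    by move=> Ir; apply/oppr_inj; rewrite -eqn// transport// mulNr.
  have st_flip y : u t y = u s (lambda s + lambda t - y) by exact: flip.
  rewrite mulrBl -Qv// (Q_reflect _ _ _ Is st_flip) Qv//.
  by rewrite (dx_reflect _ _ _ st_flip) mulrN opprK addNr.
have [[x0 x0P]|dx0] := pselect (exists x, dx u t1 x != 0).
  (* The shift by [v t1 * t1] makes the wave agree with [u t1] at time [t1]. *)
  exists (v t1), (fun z => u t1 (z + v t1 * t1)).
  have affine t : I t -> lambda t - v t1 * t = lambda t1 - v t1 * t1.
    move=> It; pose f t := lambda t - v t1 * t.
    apply: (derivable_in0_cst (f := f) hI) => // {It}t It.
    have -> : 0 = v t - v t1 :> R.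
      apply/esym/eqP; have := speed t t1 x0 It It1.
      by move/eqP; rewrite mulf_eq0 (negbTE x0P) orbF subr_eq0 eq_sym subr_eq0.
    apply: cvg_within_filter.
    have H : (fun s => difference_quotient lambda t s - v t1) @ t^' -->
        v t - v t1.
      by apply: cvgB; [exact: v_lim|exact: cvg_cst].
    apply: cvg_trans H; apply: near_eq_cvg; near=> s.
    rewrite /difference_quotient /f.
    have st : s - t != 0.
      by rewrite subr_eq0; near: s; exact: nbhs_dnbhs_neq.
    by field.
  move=> t x It; have := frozen (x - lambda t) t t1 It It1.
  rewrite subrK => ->; congr (u t1 _); have := affine t It; lra.
(* Here [dx u t1] vanishes identically, so [u t1] is constant, and [flip] carries its value to every
   time. *)
have ucst x y : u t1 x = u t1 y.
  have H z : is_derive z (1 : R) (u t1) 0.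
    split; first exact: ux.
    rewrite -derive1E; apply/eqP/negP => /negP dz; apply: dx0; by exists z.
  exact: is_derive_0_is_cst.
exists 0, (u t1) => t x It; rewrite (flip t1 t x It1 It); exact: ucst.
Unshelve. all: by end_near.
Qed.
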